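(* Let $\Gamma$ be a non-elementary hyperbolic group, let $S$ and $S_\ast$ be finite symmetric sets of generators of $\Gamma$, and let $d=d_{S_\ast}$ be the word metric associated to $S_\ast$. Let $$I(s)=\theta_{d/d_S}(0)+\sup_{t\in\mathbb{R}}\{ts-\theta_{d/d_S}(-t)\},\quad \alpha_{\min}=-\lim_{a\to\infty}\frac{\theta_{d/d_S}(a)}{a},\quad \alpha_{\max}=-\lim_{a\to-\infty}\frac{\theta_{d/d_S}(a)}{a}.$$ Then $I(\alpha_{\min}),I(\alpha_{\max})<\infty$, and further $\alpha_{\min}$ and $\alpha_{\max}$ are rational.
   Context: For a finite symmetric generating set $S$ of $\Gamma$ (identity $o$), $|x|_S$ is the word length of $x$, and $d_S(x,y)=|x^{-1}y|_S$. $\Gamma$ is hyperbolic if $(\Gamma,d_S)$ is Gromov hyperbolic for some (equivalently, every) $S$; a hyperbolic group is non-elementary if it is non-amenable (equivalently, neither finite nor virtually $\mathbb{Z}$). $\theta_{d/d_S}$ is the Manhattan curve for the pair $d$, $d_S$: $\theta_{d/d_S}(a)=\lim_{n\to\infty}\frac1n\log\sum_{|x|_S=n}e^{-a\,d(o,x)}$ for $a\in\mathbb{R}$, equivalently the abscissa of convergence in $b$ of $\sum_{x\in\Gamma}\exp(-a\,d(o,x)-b|x|_S)$. The function $I$ is the rate function of the large deviation principle for $d(o,x)/n$ with $x$ uniformly distributed on $\{x\in\Gamma:|x|_S=n\}$. *)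

(* Defs.v *)
From HB Require Import structures.
From mathcomp Require Import all_boot all_order all_algebra finmap.
From mathcomp Require Import all_classical all_reals all_analysis.
Set Implicit Arguments.
Unset Strict Implicit.
Unset Printing Implicit Defensive.
Import Order.TTheory GRing.Theory Num.Theory.
Import numFieldNormedType.Exports.
Local Open Scope classical_set_scope.
Local Open Scope ring_scope.

Section Words.
Variable Gam : groupType.
Implicit Types (S : {fset Gam}) (x y : Gam) (w : seq Gam).

Definition is_word S x w : Prop :=
  {subset w <= S} /\ (\prod_(s <- w) s)%g = x.

(* As S is closed under inverses, the subgroup it generates consists of the
   products of elements of S. *)
Definition symmetric_generators S : Prop :=
  (forall s, s \in S -> (s^-1)%g \in S) /\
  (forall x, exists w, is_word S x w).

(* The least length of an S-word representing x; the default value 0 of xget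
   is only reached when x is not a product of elements of S. *)
Definition word_length S x : nat :=
  xget 0%N [set n | (exists2 w, is_word S x w & size w = n) /\
                    (forall w, is_word S x w -> (n <= size w)%N)].

Definition word_sphere S (n : nat) : set Gam :=
  [set x | word_length S x = n].

Definition word_metric (R : realType) S x y : R :=
  (word_length S (x^-1 * y)%g)%:R.

End Words.
Arguments word_metric {Gam} R S x y.

Definition gromov_product (R : realType) (T : Type) (d : T -> T -> R)
  (w x y : T) : R := (d w x + d w y - d x y) / 2.

Definition gromov_hyperbolic (R : realType) (T : Type) (d : T -> T -> R)
  : Prop :=
  exists2 delta : R, 0 <= delta & forall w x y z : T,
    Num.min (gromov_product d w x y) (gromov_product d w y z) - delta
      <= gromov_product d w x z.

Definition hyperbolic_group (R : realType) (Gam : groupType) : Prop :=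
  exists2 S : {fset Gam}, symmetric_generators S &
    gromov_hyperbolic (word_metric R S).

(* Existence of a left-invariant finitely additive probability measure defined
   on all subsets (Gam is a discrete group). *)
Definition amenable (R : realType) (Gam : groupType) : Prop :=
  exists mu : set Gam -> R,
    [/\ mu setT = 1,
        forall A, 0 <= mu A,
        forall A B, A `&` B = set0 -> mu (A `|` B) = mu A + mu B &
        forall (g : Gam) A, mu [set (g * x)%g | x in A] = mu A].

Definition non_elementary_hyperbolic (R : realType) (Gam : groupType) : Prop :=
  hyperbolic_group R Gam /\ ~ amenable R Gam.

Section Manhattan.
Variables (R : realType) (Gam : groupType).
Variables (d : Gam -> Gam -> R) (S : {fset Gam}).

(* The sum is over a finite set, since S is finite. *)
Definition manhattan_seq (a : R) (n : nat) : R :=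
  n%:R^-1 * ln (\sum_(x \in word_sphere S n) expR (- a * d 1%g x)).

Definition manhattan_curve (a : R) : R := limn (manhattan_seq a).

Definition rate_function (s : R) : \bar R :=
  ((manhattan_curve 0)%:E +
   ereal_sup [set (t * s - manhattan_curve (- t))%:E | t in [set: R]])%E.

Definition alpha_min : R := - lim (manhattan_curve a / a @[a --> +oo]).

Definition alpha_max : R := - lim (manhattan_curve a / a @[a --> -oo]).

(* lim takes a default value on divergent filters: this says that all the
   limits in the three definitions above exist. *)
Definition manhattan_limits_exist : Prop :=
  [/\ forall a, cvgn (manhattan_seq a),
      cvg (manhattan_curve a / a @[a --> +oo]) &
      cvg (manhattan_curve a / a @[a --> -oo])].

End Manhattan.

Definition is_rational (R : realType) (x : R) : Prop :=
  exists q : rat, x = ratr q.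

(* Main.v *)
Require Import Defs.
From mathcomp Require Import all_boot all_order all_algebra finmap.
From mathcomp Require Import all_classical all_reals all_analysis.
From mathcomp Require Import zify ring lra.
Import Order.TTheory GRing.Theory Num.Theory.
Import numFieldNormedType.Exports.

Set Implicit Arguments.
Unset Strict Implicit.
Unset Printing Implicit Defensive.

(* Write |x| for the S-length and |x|' for the Sstar-length of x, and let d0 be a
   hyperbolic word metric; S- and Sstar-geodesics are quasi-geodesics for d0.
   Stability of quasi-geodesics has two consequences.
   (1) If |xu| = |x| + |u|, then |xu|' and |x|' + |u|' differ by a bounded amount.
   Hence log of the partition sum over the n-sphere is subadditive in n up to a
   constant, so the Manhattan curve theta exists, and so do the limits beta of
   m_n / n, where m_n is the minimum (or the maximum) of |x|' on the n-sphere.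
   Keeping one term of the partition sum gives theta(a) >= - a beta for every a,
   and bounding all terms by the extremal one gives
   theta(a) <= - a beta + theta(0) for a of the relevant sign. So the slopes of
   theta at infinity are - beta, and I(beta) <= theta(0).
   (2) Fix N and r large, and let the state of x be the function
   g |-> (|xg| - |x|, |xg|' - |x|') on the d0-ball of radius r. There are finitely
   many states, and the state of x together with a block u of S-length N
   determines whether |xu| = |x| + N, the state of xu and |xu|' - |x|'. So beta N
   is the minimal (or maximal) mean weight of a cycle in a finite graph with
   integral weights, and beta is rational. *)

(** * Stability of quasi-geodesics *)

Section HyperbolicMetric.
Variables (T : Type) (d : T -> T -> nat) (Delta : nat).
Hypothesis dxx : forall x, d x x = 0.
Hypothesis dC : forall x y, d x y = d y x.
Hypothesis d_triangle : forall x y z, d x z <= d x y + d y z.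
Hypothesis d_four_point : forall w x y z,
  d x z + d w y <= maxn (d x y + d w z) (d y z + d w x) + Delta.

Definition geodesic_path (p : nat -> T) (n : nat) :=
  forall i j, i <= j -> j <= n -> d (p i) (p j) = j - i.

(** Purely multiplicative bounds: the paths of interest are geodesics of another, bilipschitz
    equivalent, word metric. *)
Definition quasi_geodesic_path (L : nat) (q : nat -> T) (n : nat) :=
  forall i j, i <= j -> j <= n ->
    d (q i) (q j) <= L * (j - i) /\ j - i <= L * d (q i) (q j).

Hypothesis d_geodesic : forall x y,
  exists p, [/\ p 0 = x, p (d x y) = y & geodesic_path p (d x y)].

(** The hypothesis bounds twice the Gromov product at [w] of consecutive points below by [c].
    Halving the chain costs one four-point inequality, hence one [Delta], at each of the [k] dyadic
    levels. *)
Lemma gromov_product_chain k (z : nat -> T) n w c : 0 < n <= 2 ^ k ->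
  (forall i, i < n -> c + d (z i) (z i.+1) <= d w (z i) + d w (z i.+1)) ->
  c + d (z 0) (z n) <= d w (z 0) + d w (z n) + k * Delta.
Proof.
elim: k z n => [|k IH] z n n_bound z_step.
  have -> : n = 1 by rewrite expn0 in n_bound; lia.
  by have := z_step 0; lia.
have [n1|n_gt1] := leqP n 1.
  have n1' : n = 1 by lia.
  by subst n; have := z_step 0; nia.
pose h := n./2.
have [h_gt0 [h_lt h_le]] : 0 < h /\ h < n /\ (h <= 2 ^ k /\ n - h <= 2 ^ k).
  by rewrite expnS in n_bound; rewrite /h; lia.
have low := IH z h; have high := IH (fun i => z (h + i)) (n - h).
rewrite /= addn0 subnKC in high; last exact: ltnW.
have {}low := low _ (fun i lt_ih => z_step i (ltn_trans lt_ih h_lt)).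
have {}high : c + d (z h) (z n) <= d w (z h) + d w (z n) + k * Delta.
  by apply: high; [lia | move=> i lt_i; rewrite addnS; apply: z_step; lia].
have {}low := low ltac:(lia).
have := d_four_point w (z 0) (z h) (z n); rewrite mulSn; lia.
Qed.

Lemma linear_lt_exp2 a b : exists k0, forall k, k0 <= k -> a * k + b <= 2 ^ k.
Proof.
exists (4 + a + b) => k le_k.
have sqr_le : k * k <= 2 ^ k.
  have : 4 <= k by lia.
  elim: k {le_k} => // k IH; rewrite leq_eqVlt => /orP[/eqP <- //|k_ge4].
  by have := IH k_ge4; rewrite expnS; nia.
by nia.
Qed.

(** For [k = D %/ Delta.+1] one has [k * Delta <= D], so [2 * D <= L + k * Delta] would give
    [D <= L]; and for large [D] this [k] is admissible, since [2 ^ k] outgrows [6 * L * D + 2]. *)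
Lemma exponential_divergence_bound L : exists D0, forall D,
  (forall k, 6 * L * D + 2 <= 2 ^ k -> 2 * D <= L + k * Delta) -> D <= D0.
Proof.
have [k0 k0P] := linear_lt_exp2 (6 * L * Delta.+1) (6 * L * Delta.+1 + 2).
exists (L + k0.+1 * Delta.+1) => D D_bound.
rewrite leqNgt; apply/negP => D_gt.
pose k := D %/ Delta.+1.
have D_div := divn_eq D Delta.+1.
have D_mod : D %% Delta.+1 < Delta.+1 by rewrite ltn_mod.
have k_ge : k0 <= k by rewrite /k leq_divRL //; nia.
have k_pow := k0P k k_ge.
have D_le : D <= k.+1 * Delta.+1 by rewrite -/k in D_div; nia.
have kDelta : k * Delta <= D by rewrite -/k in D_div; nia.
have : 2 * D <= L + k * Delta.
  apply: D_bound; apply: leq_trans k_pow.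
  have := leq_mul (leqnn (6 * L)) D_le; nia.
by nia.
Qed.

Lemma nat_argmin (F : nat -> nat) n :
  exists2 i, i <= n & forall j, j <= n -> F i <= F j.
Proof.
elim: n => [|n [i le_in minF]]; first by exists 0 => // j; rewrite leqn0 => /eqP ->.
have [leF|ltF] := leqP (F i) (F n.+1).
  exists i => [|j]; first exact: leqW.
  by rewrite leq_eqVlt ltnS => /orP[/eqP ->|/minF].
exists n.+1 => // j; rewrite leq_eqVlt ltnS => /orP[/eqP -> //|/minF].
by apply: leq_trans; apply: ltnW.
Qed.

Lemma nat_argmax (F : nat -> nat) n :
  exists2 i, i <= n & forall j, j <= n -> F j <= F i.
Proof.
elim: n => [|n [i le_in maxF]]; first by exists 0 => // j; rewrite leqn0 => /eqP ->.
have [leF|ltF] := leqP (F n.+1) (F i).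
  exists i => [|j]; first exact: leqW.
  by rewrite leq_eqVlt ltnS => /orP[/eqP ->|/maxF].
exists n.+1 => // j; rewrite leq_eqVlt ltnS => /orP[/eqP -> //|/maxF leFj].
exact: leq_trans leFj (ltnW ltF).
Qed.

(* At a point [p j] of the geodesic at maximal distance [D] from [q], the
   detour that follows [q] between points close to [p (j - 2D)] and
   [p (j + 2D)] has O(D) steps and stays at distance [D] from [p j]; the chain
   lemma then gives D = O(log D). *)
Lemma geodesic_near_quasi_geodesic L : exists D0, forall p q m n,
  geodesic_path p m -> quasi_geodesic_path L q n -> p 0 = q 0 -> p m = q n ->
  forall j, j <= m -> exists2 i, i <= n & d (p j) (q i) <= D0.
Proof.
have [D0 D0P] := exponential_divergence_bound L.
exists D0 => p q m n p_geo q_geo p0 pm.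
have /choice [idx idxP] : forall j, exists i,
    i <= n /\ forall i', i' <= n -> d (p j) (q i) <= d (p j) (q i').
  by move=> j; have [i] := nat_argmin (fun i => d (p j) (q i)) n; exists i.
pose D j := d (p j) (q (idx j)).
have [j le_jm D_max] := nat_argmax D m.
suff {}D_le : D j <= D0.
  move=> j' le_j'm; exists (idx j'); first by case: (idxP j').
  exact: leq_trans (D_max _ le_j'm) D_le.
apply: D0P => k k_pow.
have [a a_def] : exists a, a = j - 2 * D j by exists (j - 2 * D j).
have [b b_def] : exists b, b = minn (j + 2 * D j) m by exists (minn (j + 2 * D j) m).
have a_near : d (p a) (q (idx a)) <= D j by apply: D_max; lia.
have b_near : d (p b) (q (idx b)) <= D j by apply: D_max; lia.
have far i : i <= n -> D j <= d (p j) (q i) by case: (idxP j) => _; apply.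
have a_le : idx a <= n by case: (idxP a).
have b_le : idx b <= n by case: (idxP b).
have daj : d (p j) (p a) = j - a by rewrite dC p_geo //; lia.
have djb : d (p j) (p b) = b - j by rewrite p_geo //; lia.
have dab : d (p a) (p b) = b - a by rewrite p_geo //; lia.
(* If the window is cut off at [0], then [p a] lies on [q] and both distances on the right are at
   least [D j]; otherwise the first of them is [2 * D j]. *)
have start : 2 * D j + d (p a) (q (idx a)) <=
    d (p j) (p a) + d (p j) (q (idx a)).
  have far_a := far _ a_le.
  have [le_j|lt_j] := leqP j (2 * D j); last by rewrite daj; lia.
  have a0 : a = 0 by lia.
  have : d (p a) (q (idx a)) = 0.
    by have [_ /(_ 0 isT)] := idxP 0; rewrite a0 p0 dxx leqn0 => /eqP.
  by have := d_triangle (p j) (p a) (q (idx a)); lia.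
have finish : 2 * D j + d (q (idx b)) (p b) <=
    d (p j) (q (idx b)) + d (p j) (p b).
  have far_b := far _ b_le.
  rewrite [d (q _) _]dC.
  have [le_j|lt_j] := leqP (j + 2 * D j) m; first by rewrite djb; lia.
  have bm : b = m by lia.
  have : d (p b) (q (idx b)) = 0.
    by have [_ /(_ n (leqnn n))] := idxP m; rewrite bm pm dxx leqn0 => /eqP.
  by have := d_triangle (p j) (p b) (q (idx b)); lia.
have q_step t : t < n -> d (q t) (q t.+1) <= L.
  by move=> lt_t; have [] := q_geo t t.+1 (leqnSn t) lt_t; rewrite subSnn muln1.
(* The nearest points may occur in reverse order along [q]; [l] is the absolute difference of their
   indices, as one of the truncated differences vanishes. *)
pose l := (idx b - idx a) + (idx a - idx b).
pose r t := if idx a <= idx b then q (idx a + t) else q (idx a - t).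
have r0 : r 0 = q (idx a) by rewrite /r addn0 subn0; case: ifP.
have rl : r l = q (idx b).
  by rewrite /r /l; case: (leqP (idx a) (idx b)) => ?; congr q; lia.
have r_step t : t < l ->
    [/\ d (r t) (r t.+1) <= L, D j <= d (p j) (r t) & D j <= d (p j) (r t.+1)].
  rewrite /r /l; case: (leqP (idx a) (idx b)) => le_ab lt_t; split;
    try by apply: far; lia.
    by rewrite addnS; apply: q_step; lia.
  have -> : idx a - t = (idx a - t.+1).+1 by lia.
  by rewrite dC; apply: q_step; lia.
have l_le : l <= L * (6 * D j).
  have dq : d (q (idx a)) (q (idx b)) <= 6 * D j.
    have := d_triangle (q (idx a)) (p a) (q (idx b)).
    have := d_triangle (p a) (p b) (q (idx b)).
    rewrite [d (q _) (p a)]dC.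
    suff : d (p a) (p b) <= 4 * D j by lia.
    by rewrite dab; lia.
  apply: leq_trans (leq_mul (leqnn L) dq).
  have [le_ab|lt_ba] := leqP (idx a) (idx b).
    by have := q_geo _ _ le_ab b_le; rewrite /l; lia.
  by have := q_geo _ _ (ltnW lt_ba) a_le; rewrite dC /l; lia.
pose z t := if t is t'.+1 then if t' <= l then r t' else p b else p a.
have zl : z l.+2 = p b by rewrite /z ltnn.
have [small|big] := leqP (2 * D j) L; first by lia.
(* Steps along [q] have length at most [L] and endpoints at distance at least [D j] from [p j],
   whence [2 * D j - L]. Since [p j] lies between [p a] and [p b] on a geodesic, the distances to
   the ends cancel. *)
have := @gromov_product_chain k z l.+2 (p j) (2 * D j - L).
rewrite zl /= daj djb dab.
suff chain_step : forall i, i < l.+2 -> 2 * D j - L + d (z i) (z i.+1) <=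
    d (p j) (z i) + d (p j) (z i.+1).
  by move=> /(_ ltac:(lia) chain_step); lia.
case=> [|i] lt_i /=; first by rewrite r0; lia.
have le_il : i <= l by lia.
rewrite le_il.
have [->|ne_il] := eqVneq i l; first by rewrite ltnn rl; lia.
have lt_il : i < l by lia.
by have := r_step i lt_il; rewrite lt_il => -[]; lia.
Qed.

(** A connectedness argument: for the last [p j] that is close to some [q i1] with [i1 <= i], the
    next point of [p] is close to some [q i2] with [i <= i2]. Then [i2 - i1] is bounded, so [q i] is
    close to [p j]. *)
Lemma quasi_geodesic_near_geodesic L : exists K, forall q n,
  quasi_geodesic_path L q n ->
  forall i, i <= n ->
    d (q i) (q 0) + d (q i) (q n) <= d (q 0) (q n) + K.
Proof.
have [D0 D0P] := geodesic_near_quasi_geodesic L.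
exists (2 * (D0 + L * (L * (2 * D0 + 1)))) => q n q_geo i le_in.
have [p [p0 pm p_geo]] := d_geodesic (q 0) (q n).
set m := d (q 0) (q n) in pm p_geo.
have near := D0P p q m n p_geo q_geo p0 pm.
suff [j le_jm dij] : exists2 j, j <= m &
    d (q i) (p j) <= D0 + L * (L * (2 * D0 + 1)).
  have := d_triangle (q i) (p j) (q 0); have := d_triangle (q i) (p j) (q n).
  have := p_geo 0 j isT le_jm; have := p_geo j m le_jm (leqnn m).
  by rewrite pm p0 [d (p j) (q 0)]dC; lia.
have [j0 [ltj0 [i1 [i2 [le1 le2 le2n d1 d2]]]]] : exists j, j <= m /\
    exists i1 i2, [/\ i1 <= i, i <= i2, i2 <= n, d (p j) (q i1) <= D0 &
      d (p j) (q i2) <= D0 + 1].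
  pose P j := (j <= m) && `[< exists2 i1, i1 <= i & d (p j) (q i1) <= D0 >].
  have exP : exists j, P j.
    by exists 0; apply/andP; split=> //; apply/asboolP; exists 0 => //; rewrite p0 dxx.
  have bP j : P j -> j <= m by case/andP.
  case: (ex_maxnP exP bP) => j /andP[le_jm /asboolP[i1 le_i1 d1]] j_max.
  exists j; split=> //; exists i1.
  have [j_eq|ne_jm] := eqVneq j m.
    by exists n; split=> //; rewrite j_eq pm dxx.
  have lt_jm : j < m by lia.
  have [i2 le_i2n d2] := near _ lt_jm.
  exists i2; split=> //.
    rewrite leqNgt; apply/negP => lt_i2i.
    suff /j_max : P j.+1 by rewrite ltnn.
    by apply/andP; split=> //; apply/asboolP; exists i2 => //; apply: ltnW.
  by have := d_triangle (p j) (p j.+1) (q i2); rewrite (p_geo j j.+1) //; lia.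
exists j0 => //.
have d12 : d (q i1) (q i2) <= 2 * D0 + 1.
  by have := d_triangle (q i1) (p j0) (q i2); rewrite [d (q i1) (p _)]dC; lia.
have [_ i12] := q_geo i1 i2 (leq_trans le1 le2) le2n.
have [di1 _] := q_geo i1 i le1 le_in.
have := d_triangle (q i) (q i1) (p j0).
rewrite [d (q i) (q i1)]dC [d (q i1) (p j0)]dC.
have := leq_mul (leqnn L) d12.
have : i - i1 <= i2 - i1 by lia.
move=> le12 le_L; have := leq_mul (leqnn L) (leq_trans le12 (leq_trans i12 le_L)).
lia.
Qed.

(** A converse to the previous lemma: the four-point condition puts [x] close to a point of a
    geodesic between the ends of [q], and the geodesic stays close to [q]. *)
Lemma small_gromov_product_near_quasi_geodesic L K : exists K', forall q n x,
  quasi_geodesic_path L q n ->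
  d x (q 0) + d x (q n) <= d (q 0) (q n) + K ->
  exists2 i, i <= n & d x (q i) <= K'.
Proof.
have [D0 D0P] := geodesic_near_quasi_geodesic L.
exists (K + Delta + 2 + D0) => q n x q_geo x_prod.
have [p [p0 pm p_geo]] := d_geodesic (q 0) (q n).
set m := d (q 0) (q n) in pm p_geo x_prod.
have t1 := d_triangle x (q 0) (q n); have t2 := d_triangle (q 0) x (q n).
have t3 := d_triangle x (q n) (q 0).
rewrite [d (q 0) x]dC [d (q n) (q 0)]dC -/m in t1 t2 t3.
(* [j] is the Gromov product of [x] and [q n] at [q 0], rounded down: the place on [p] where [x]
   projects. *)
have [j j_def] : exists j, j = (d x (q 0) + m - d x (q n))./2 by eexists.
have le_jm : j <= m by lia.
have dj0 := p_geo 0 j isT le_jm; have djm := p_geo j m le_jm (leqnn m).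
rewrite p0 in dj0; rewrite pm in djm.
have [i le_in di] := D0P p q m n p_geo q_geo p0 pm j le_jm.
exists i => //.
have := d_triangle x (p j) (q i).
have := d_four_point (p j) (q 0) x (q n).
rewrite [d (q 0) x]dC [d (p j) (q 0)]dC dj0 djm -/m [d (p j) x]dC.
lia.
Qed.

End HyperbolicMetric.

(** * Word metrics *)

Section WordLength.
Local Open Scope group_scope.
Variables (Gam : groupType) (S : {fset Gam}).
Hypothesis hS : symmetric_generators S.
Implicit Types (x y z : Gam) (w : seq Gam).

Let len := word_length S.

Lemma word_length_spec x :
  (exists2 w, is_word S x w & size w = len x) /\
  (forall w, is_word S x w -> (len x <= size w)%N).
Proof.
rewrite /len /word_length; case: xgetP => [n _ //|no_min].
have exP : exists n, `[< exists2 w, is_word S x w & size w = n >].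
  by have [w xw] := hS.2 x; exists (size w); apply/asboolP; exists w.
case: (ex_minnP exP) => n /asboolP n_word n_min.
case: (no_min n); split=> // w xw.
by apply: n_min; apply/asboolP; exists w.
Qed.

Lemma shortest_word x : exists2 w, is_word S x w & size w = len x.
Proof. by case: (word_length_spec x). Qed.

Lemma word_length_le x w : is_word S x w -> (len x <= size w)%N.
Proof. by case: (word_length_spec x) => _; apply. Qed.

Lemma is_word_cat x y v w : is_word S x v -> is_word S y w ->
  is_word S (x * y) (v ++ w).
Proof.
move=> [vS <-] [wS <-]; split; last by rewrite big_cat.
by move=> s; rewrite mem_cat => /orP[/vS|/wS].
Qed.

Lemma word_length1 : len 1 = 0%N.
Proof.
apply/eqP; rewrite -leqn0; apply: (@word_length_le 1 [::]).
by split; rewrite ?big_nil.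
Qed.

Lemma word_lengthM x y : (len (x * y) <= len x + len y)%N.
Proof.
have [v xv <-] := shortest_word x; have [w yw <-] := shortest_word y.
by rewrite -size_cat; apply: word_length_le; apply: is_word_cat.
Qed.

Lemma word_length_generator s : s \in S -> (len s <= 1)%N.
Proof.
move=> sS; apply: (@word_length_le s [:: s]); split; last by rewrite big_seq1.
by move=> t; rewrite inE => /eqP ->.
Qed.

Lemma word_lengthV_le x : (len x^-1 <= len x)%N.
Proof.
have [w [wS <-] <-] := shortest_word x.
elim: w wS => [|s w IH] wS; first by rewrite big_nil invg1 word_length1.
rewrite big_cons invgM; apply: leq_trans (word_lengthM _ _) _.
rewrite /= -addn1; apply: leq_add.
  by apply: IH => t tw; apply: wS; rewrite inE tw orbT.
by apply/word_length_generator/hS.1/wS; rewrite mem_head.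
Qed.

Lemma word_lengthV x : len x^-1 = len x.
Proof.
apply/eqP; rewrite eqn_leq word_lengthV_le /=.
by have := word_lengthV_le x^-1; rewrite invgK.
Qed.

Lemma word_length_split x n : (n <= len x)%N ->
  exists y z, [/\ x = y * z, len y = n & len z = (len x - n)%N].
Proof.
have [w [wS wx] w_size] := shortest_word x => le_n.
pose y := \prod_(s <- take n w) s; pose z := \prod_(s <- drop n w) s.
have xyz : x = y * z by rewrite /y /z -big_cat cat_take_drop.
have ley : (len y <= n)%N.
  have -> : n = size (take n w) by rewrite size_takel // w_size.
  by apply: word_length_le; split=> // s /mem_take/wS.
have lez : (len z <= len x - n)%N.
  rewrite -w_size -size_drop.
  by apply: word_length_le; split=> // s /mem_drop/wS.
have := word_lengthM y z; rewrite -xyz => le_yz.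
by exists y, z; split=> //; lia.
Qed.

Lemma word_ball_finite n : exists s : seq Gam,
  forall x, (len x <= n)%N -> x \in s.
Proof.
elim: n => [|n [s sP]].
  exists [:: 1] => x; rewrite leqn0 => /eqP x0.
  have [w [_ wx] w_size] := shortest_word x; rewrite x0 in w_size.
  by rewrite -wx (size0nil w_size) big_nil inE.
exists (s ++ [seq a * y | a <- S, y <- s]) => x.
rewrite leq_eqVlt ltnS mem_cat => /orP[/eqP x_len|/sP -> //].
have [w [wS wx] w_size] := shortest_word x.
case: w wS wx w_size => [|a w] wS wx w_size; first by rewrite x_len in w_size.
rewrite -wx big_cons; apply/orP; right.
apply/allpairsP; exists (a, \prod_(s <- w) s); split=> //=.
  by apply: wS; rewrite mem_head.
apply: sP; rewrite x_len in w_size; case: w_size => <-.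
apply: word_length_le; split=> // t tw; apply: wS; by rewrite inE tw orbT.
Qed.

Definition word_dist x y := len (x^-1 * y).

Lemma word_distxx x : word_dist x x = 0%N.
Proof. by rewrite /word_dist mulVg word_length1. Qed.

Lemma word_distC x y : word_dist x y = word_dist y x.
Proof. by rewrite /word_dist -word_lengthV invgM invgK. Qed.

Lemma word_dist_triangle x y z :
  (word_dist x z <= word_dist x y + word_dist y z)%N.
Proof.
rewrite /word_dist.
have -> : x^-1 * z = (x^-1 * y) * (y^-1 * z) by rewrite !mulgA mulgK.
exact: word_lengthM.
Qed.

Lemma word_dist_left g x y : word_dist (g * x) (g * y) = word_dist x y.
Proof. by rewrite /word_dist invgM -!mulgA mulKg. Qed.

Lemma word_dist1 x : word_dist 1 x = len x.
Proof. by rewrite /word_dist invg1 mul1g. Qed.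

(** Prefixes of lengths [i] and [j] differ by a word of length [j - i]; a shortcut between them
    would shorten the whole word. *)
Lemma is_word_geodesic_path w x : is_word S x w -> size w = len x ->
  geodesic_path word_dist (fun i => \prod_(s <- take i w) s) (len x).
Proof.
move=> [wS <-]; set y := \prod_(s <- w) s => w_size.
pose p (i : nat) := \prod_(s <- take i w) s.
rewrite -[fun i => _]/p.
have step i j : (i <= j)%N -> (word_dist (p i) (p j) <= j - i)%N.
  move=> le_ij; rewrite /word_dist /p.
  have -> : take j w = take i w ++ take (j - i) (drop i w).
    by rewrite -{1}(subnKC le_ij) takeD.
  rewrite big_cat mulKg; set v := take _ _.
  apply: (@leq_trans (size v)); last by rewrite size_take_min geq_minl.
  by apply: word_length_le; split=> // s /mem_take/mem_drop/wS.
move=> i j le_ij le_jn.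
have p0 : p 0 = 1 by rewrite /p take0 big_nil.
have pn : p (len y) = y by rewrite /p -w_size take_size.
have := step _ _ le_ij; have := step _ _ le_jn; have := step 0%N i isT.
have := word_dist_triangle (p 0) (p i) y.
have := word_dist_triangle (p i) (p j) y.
rewrite {1}p0 word_dist1 pn; lia.
Qed.

Lemma geodesic_path_through x u : len (x * u) = (len x + len u)%N ->
  exists p, [/\ p 0 = 1, p (len x) = x, p (len (x * u)) = x * u &
    geodesic_path word_dist p (len (x * u))].
Proof.
move=> xu_len; have [v xv v_size] := shortest_word x.
have [w uw w_size] := shortest_word u.
have vw := is_word_cat xv uw.
have vw_size : size (v ++ w) = len (x * u) by rewrite size_cat v_size w_size.
exists (fun i => \prod_(s <- take i (v ++ w)) s); split.
- by rewrite take0 big_nil.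
- by rewrite -v_size take_size_cat //; case: xv.
- by rewrite -vw_size take_size; case: vw.
- exact: is_word_geodesic_path.
Qed.

Lemma word_dist_geodesic x y : exists p,
  [/\ p 0 = x, p (word_dist x y) = y & geodesic_path word_dist p (word_dist x y)].
Proof.
have [|p [p0 _ pn p_geo]] := @geodesic_path_through 1 (x^-1 * y).
  by rewrite mul1g word_length1.
rewrite mul1g in pn p_geo; exists (fun i => x * p i); split.
- by rewrite p0 mulg1.
- by rewrite /word_dist pn mulVKg.
- by move=> i j le_ij le_jn; rewrite word_dist_left p_geo.
Qed.

End WordLength.

Lemma word_length_eq0 (Gam : groupType) (S : {fset Gam}) (x : Gam) :
  symmetric_generators S -> word_length S x = 0 -> x = 1%g.
Proof.
move=> hS x0; have [w [_ wx] w_size] := shortest_word hS x.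
by rewrite x0 in w_size; rewrite -wx (size0nil w_size) big_nil.
Qed.

(** One side only; exchanging [S] and [S'] gives the other. The constant bounds the [S']-length of
    each generator in [S]. *)
Lemma word_length_bilipschitz (Gam : groupType) (S S' : {fset Gam}) :
  symmetric_generators S -> symmetric_generators S' ->
  exists L, forall x, word_length S' x <= L * word_length S x.
Proof.
move=> hS hS'; exists (\sum_(s <- S) word_length S' s) => x.
have [w [wS <-] <-] := shortest_word hS x.
elim: w wS => [|s w IH] wS; first by rewrite big_nil word_length1.
rewrite big_cons mulnS; apply: leq_trans (word_lengthM hS' _ _) _.
apply: leq_add; last by apply: IH => t tw; apply: wS; rewrite inE tw orbT.
have sS : s \in S by apply: wS; rewrite mem_head.
by rewrite (big_fsetD1 s sS) leq_addr.
Qed.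

Lemma geodesic_path_quasi (Gam : groupType) (S S' : {fset Gam}) :
  symmetric_generators S -> symmetric_generators S' ->
  exists L, forall p n, geodesic_path (word_dist S) p n ->
    quasi_geodesic_path (word_dist S') L p n.
Proof.
move=> hS hS'; have [L1 L1P] := word_length_bilipschitz hS hS'.
have [L2 L2P] := word_length_bilipschitz hS' hS.
exists (L1 + L2) => p n p_geo i j le_ij le_jn.
have := p_geo i j le_ij le_jn.
have := L1P ((p i)^-1 * p j)%g; have := L2P ((p i)^-1 * p j)%g.
rewrite -/(word_dist S _ _) -/(word_dist S' _ _) => ? ? <-; split; nia.
Qed.

(** The Gromov product carries a factor 1/2, so [Delta] is an integer above [2 * delta]. *)
Lemma hyperbolic_word_dist (R : realType) (Gam : groupType) (S : {fset Gam}) :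
  gromov_hyperbolic (word_metric R S) -> exists Delta, forall w x y z,
  word_dist S x z + word_dist S w y <= maxn (word_dist S x y + word_dist S w z)
    (word_dist S y z + word_dist S w x) + Delta.
Proof.
move=> [delta delta_ge0 hyp]; exists (Num.bound (2 * delta)%R) => w x y z.
have bound := ltW (archi_boundP (mulr_ge0 (ler0n R 2) delta_ge0)).
have := hyp w x y z; rewrite /gromov_product /word_metric -!/(word_dist S _ _).
rewrite -(ler_nat R) natrD; set N := ((Num.bound _)%:R)%R in bound *.
rewrite natrD natr_max !natrD.
rewrite maxEle minEle; do 2 case: ifP; lra.
Qed.

(* The group laws reach the same product through different canonical instances,
   which [lia] does not identify; lengths are generalized up to conversion first. *)
Ltac length_lia :=
  repeat match goal with
  | H : is_true (leq _ _) |- _ => revert H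
  | H : @eq nat _ _ |- _ => revert H
  end;
  repeat match goal with
  | |- context [word_length ?A ?x] => move: (word_length A x) => ?
  end; lia.

(** * Comparison of word lengths along geodesics of a hyperbolic group *)

Section WordHyperbolic.
Local Open Scope group_scope.
Variables (Gam : groupType) (S0 : {fset Gam}) (Delta : nat).
Hypothesis hS0 : symmetric_generators S0.
Hypothesis S0_hyperbolic : forall w x y z,
  (word_dist S0 x z + word_dist S0 w y <=
   maxn (word_dist S0 x y + word_dist S0 w z)
        (word_dist S0 y z + word_dist S0 w x) + Delta)%N.
Implicit Types (S A : {fset Gam}) (x y u g h : Gam).

(** [x] lies on an [S]-geodesic from [1] to [x * u], which is a quasi-geodesic for [S0]. *)
Lemma geodesic_split_product S : symmetric_generators S ->
  exists K, forall x u,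
    word_length S (x * u) = (word_length S x + word_length S u)%N ->
    (word_length S0 x + word_length S0 u <= word_length S0 (x * u) + K)%N.
Proof.
move=> hS; have [L quasi] := geodesic_path_quasi hS hS0.
have [K KP] := quasi_geodesic_near_geodesic (word_distxx hS0) (word_distC hS0)
  (word_dist_triangle hS0) S0_hyperbolic (word_dist_geodesic hS0) L.
exists K => x u /[dup] xu_len /(geodesic_path_through hS) [p [p0 px pn p_geo]].
have := KP p _ (quasi _ _ p_geo) (word_length S x).
rewrite px p0 pn [word_dist S0 x 1](word_distC hS0) !word_dist1 xu_len leq_addr.
by rewrite /word_dist mulKg; apply.
Qed.

(** [x * h] is a point close to [x] on an [A]-geodesic from [1] to [y], itself a quasi-geodesic for
    [S0]. *)
Lemma small_product_split A K : symmetric_generators A ->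
  exists K', forall x y,
    (word_length S0 x + word_dist S0 x y <= word_length S0 y + K)%N ->
    exists2 h, (word_length S0 h <= K')%N &
      word_length A y = (word_length A (x * h) + word_length A (h^-1 * x^-1 * y))%N.
Proof.
move=> hA; have [L quasi] := geodesic_path_quasi hA hS0.
have [K' KP'] := small_gromov_product_near_quasi_geodesic (word_distxx hS0)
  (word_distC hS0) (word_dist_triangle hS0) S0_hyperbolic
  (word_dist_geodesic hS0) L K.
exists K' => x y xy_prod.
have [|p [p0 _]] := @geodesic_path_through _ _ hA 1 y.
  by rewrite mul1g word_length1.
rewrite mul1g => pn p_geo.
have [|i le_in xi] := KP' p _ x (quasi _ _ p_geo).
  by rewrite p0 pn [word_dist S0 x 1](word_distC hS0) !word_dist1.
exists (x^-1 * p i) => //.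
rewrite mulVKg invgM invgK -!mulgA mulVKg.
have := p_geo 0 i isT le_in; have := p_geo i _ le_in (leqnn _).
by rewrite p0 pn word_dist1 subn0 /word_dist => -> ->; rewrite subnKC.
Qed.

(** An [A]-geodesic from [1] to [x * u] passes through some [x * h] with [h] bounded; replacing
    [x * h] by [x] changes each of the two parts by at most the [A]-length of [h]. *)
Lemma word_length_geodesic_superadditive S A :
  symmetric_generators S -> symmetric_generators A ->
  exists C, forall x u,
    word_length S (x * u) = (word_length S x + word_length S u)%N ->
    (word_length A x + word_length A u <= word_length A (x * u) + C)%N.
Proof.
move=> hS hA; have [K KP] := geodesic_split_product hS.
have [K' KP'] := small_product_split K hA.
have [L LP] := word_length_bilipschitz hS0 hA.
exists (2 * (L * K'))%N => x u /KP xu.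
have [|h h_le ->] := KP' x (x * u); first by rewrite /word_dist mulKg.
rewrite -!mulgA mulKg.
have := word_lengthM hA (x * h) h^-1; have := word_lengthM hA h (h^-1 * u).
rewrite mulgK mulVKg (word_lengthV hA).
have := leq_trans (LP h) (leq_mul (leqnn L) h_le); length_lia.
Qed.

(** Equality of the two differences [|xg| - |x|] and [|yg| - |y|] on a ball, in the spirit of
    Cannon's cone types; the cross-added form avoids truncated subtraction. *)
Definition same_local_lengths A (r : nat) x y := forall g,
  (word_length S0 g <= r)%N ->
  (word_length A (x * g) + word_length A y =
   word_length A (y * g) + word_length A x)%N.

(* A point [Y] within [r] of the end of a long geodesic block [u] starting at
   [x] is either within [r] of [x] itself, or separated from the identity by [x];
   in both cases the length of [Y] is computed from lengths near [x]. *)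
Lemma block_ball_split S A : symmetric_generators S -> symmetric_generators A ->
  exists N0, forall N, (N0 <= N)%N -> exists r0, forall r x u g, (r0 <= r)%N ->
    word_length S u = N -> word_length S (x * u) = (word_length S x + N)%N ->
    (word_length S0 g <= r)%N ->
    exists2 h, (word_length S0 h <= r)%N &
      word_length A (x * u * g) =
      (word_length A (x * h) + word_length A (h^-1 * u * g))%N.
Proof.
move=> hS hA; have [K KP] := geodesic_split_product hS.
have [K' KP'] := small_product_split (K + Delta) hA.
have [L LP] := word_length_bilipschitz hS0 hS.
(* This length forces the [S0]-length of the block above [K + Delta]. *)
exists (L * (K + Delta)).+1 => N N_ge; exists K' => r x u g r_ge u_len xu_len g_le.
have xu : (word_length S0 x + word_length S0 u <= word_length S0 (x * u) + K)%N.
  by apply: KP; rewrite u_len.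
have u_long : (K + Delta < word_length S0 u)%N.
  have := LP u; rewrite u_len => /(leq_trans N_ge).
  by rewrite ltn_mul2l => /andP[].
have [ug_le|ug_gt] := leqP (word_length S0 (u * g)) r.
  exists (u * g) => //.
  by rewrite -!mulgA mulVg word_length1 // addn0.
have [|h h_le ->] := KP' x (x * u * g); last first.
  by exists h; [exact: leq_trans r_ge | rewrite -!mulgA mulKg].
(* The second branch of the maximum would give [|u| + |ug| <= |g| + K + Delta] in [S0]-length,
   impossible as [|u| > K + Delta] and [|ug| > r >= |g|]. The first branch is the required bound. *)
have := S0_hyperbolic x 1 (x * u * g) (x * u).
have -> : word_dist S0 (x * u * g) (x * u) = word_length S0 g.
  by rewrite (word_distC hS0) /word_dist mulKg.
have -> : word_dist S0 x (x * u) = word_length S0 u by rewrite /word_dist mulKg.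
have -> : word_dist S0 x (x * u * g) = word_length S0 (u * g).
  by rewrite /word_dist -!mulgA mulKg.
rewrite !word_dist1 [word_dist S0 x 1](word_distC hS0) word_dist1.
length_lia.
Qed.

(** Writing [x * u * g] as an [A]-geodesic product through [x * h] with [h] in the ball, and
    following the same route from [y], bounds the length of [y * u * g]; exchanging [x] and [y]
    gives equality. *)
Lemma same_local_lengths_step S A : symmetric_generators S ->
  symmetric_generators A ->
  exists N0, forall N, (N0 <= N)%N -> exists r0, forall r x y u, (r0 <= r)%N ->
    word_length S u = N ->
    word_length S (x * u) = (word_length S x + N)%N ->
    word_length S (y * u) = (word_length S y + N)%N ->
    same_local_lengths A r x y ->
    (word_length A (x * u) + word_length A y =
     word_length A (y * u) + word_length A x)%N /\
    same_local_lengths A r (x * u) (y * u).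
Proof.
move=> hS hA; have [N0 N0P] := block_ball_split hS hA.
have [L LP] := word_length_bilipschitz hS hS0.
(* The summand [L * N] puts the block [u] itself inside the ball. *)
exists N0 => N /N0P [r0 r0P]; exists (r0 + L * N)%N => r x y u r_ge u_len xu yu eq_xy.
have eq_u : (word_length A (x * u) + word_length A y =
     word_length A (y * u) + word_length A x)%N.
  by apply: eq_xy; have := LP u; rewrite u_len; length_lia.
split=> // g g_le.
have le_half a b : word_length S (a * u) = (word_length S a + N)%N ->
    same_local_lengths A r a b ->
    (word_length A (b * u * g) + word_length A a <=
     word_length A (a * u * g) + word_length A b)%N.
  move=> au eq_ab.
  have [|h h_le ->] := r0P r a u g _ u_len au g_le; first by lia.
  have := eq_ab h h_le; have := word_lengthM hA (b * h) (h^-1 * u * g).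
  by rewrite -!mulgA mulVKg; length_lia.
have := le_half x y xu eq_xy; have := le_half y x yu (fun h hh => esym (eq_xy h hh)).
by lia.
Qed.

(** The differences on the ball lie between [- M] and [M]; shifted by [M], they are natural numbers
    below [(2 * M).+1]. *)
Lemma same_local_lengths_finite A r : symmetric_generators A ->
  exists (T : finType) (tau : Gam -> T),
    forall x y, tau x = tau y <-> same_local_lengths A r x y.
Proof.
move=> hA; have [ball ballP] := word_ball_finite hS0 r.
have [L LP] := word_length_bilipschitz hS0 hA.
pose s := [seq g <- ball | word_length S0 g <= r]%N.
have sP g : (g \in s) = (word_length S0 g <= r)%N.
  by rewrite mem_filter; case: leqP => // /ballP ->.
pose M := (L * r)%N.
pose v x g := (word_length A (x * g) + M - word_length A x)%N.
have vP x g : g \in s -> (v x g + word_length A x = word_length A (x * g) + M)%N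
    /\ (v x g < (2 * M).+1)%N.
  rewrite sP => g_le; have gM := leq_trans (LP g) (leq_mul (leqnn L) g_le).
  have := word_lengthM hA x g; have := word_lengthM hA (x * g) g^-1.
  by rewrite mulgK (word_lengthV hA) /v /M; length_lia.
pose tau x := [ffun i : 'I_(size s) => inord (v x (nth 1 s i)) : 'I_(2 * M).+1].
exists {ffun 'I_(size s) -> 'I_(2 * M).+1}, tau => x y; split=> [eq_tau g|eq_xy].
  rewrite -sP => gs; have [xg x_lt] := vP x g gs; have [yg y_lt] := vP y g gs.
  have idx : (index g s < size s)%N by rewrite index_mem.
  have := congr1 (fun f : {ffun _ -> _} => val (f (Ordinal idx))) eq_tau.
  by rewrite /= !ffunE /= !nth_index // !inordK //; lia.
apply/ffunP => i; rewrite !ffunE; congr inord.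
have gs : nth 1 s i \in s by rewrite mem_nth.
have [xg _] := vP x _ gs; have [yg _] := vP y _ gs.
by have := eq_xy _ (etrans (esym (sP _)) gs); lia.
Qed.

(** The [S]-component of the state decides which blocks prolong a geodesic, and the [A]-component
    gives the weight of the block. *)
Lemma finite_state_structure S A :
  symmetric_generators S -> symmetric_generators A ->
  exists (T : finType) (tau : Gam -> T) (N : nat), (0 < N)%N /\
    forall x y u, tau x = tau y -> word_length S u = N ->
      word_length S (x * u) = (word_length S x + N)%N ->
      [/\ word_length S (y * u) = (word_length S y + N)%N,
          tau (x * u) = tau (y * u) &
          (word_length A (x * u) + word_length A y =
           word_length A (y * u) + word_length A x)%N].
Proof.
move=> hS hA.
have [NS NSP] := same_local_lengths_step hS hS.
have [NA NAP] := same_local_lengths_step hS hA.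
pose N := (NS + NA).+1.
have [rS rSP] := NSP N (leqW (leq_addr _ _)).
have [rA rAP] := NAP N (leqW (leq_addl _ _)).
have [L LP] := word_length_bilipschitz hS hS0.
pose r := (rS + rA + L * N)%N.
have [TS [tauS tauSP]] := same_local_lengths_finite r hS.
have [TA [tauA tauAP]] := same_local_lengths_finite r hA.
exists (TS * TA)%type, (fun x => (tauS x, tauA x)), N; split=> // x y u.
move=> [/tauSP eqS /tauAP eqA] u_len xu.
have yu : word_length S (y * u) = (word_length S y + N)%N.
  have u_le : (word_length S0 u <= r)%N by have := LP u; rewrite u_len /r; length_lia.
  by have := eqS u u_le; length_lia.
have [_ eqS'] := rSP r x y u ltac:(lia) u_len xu yu eqS.
have [eqA' eqA''] := rAP r x y u ltac:(lia) u_len xu yu eqA.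
by split=> //; congr pair; [apply/tauSP | apply/tauAP].
Qed.

End WordHyperbolic.

(** * Growth of extremal values on spheres *)

Section Asymptotics.
Local Open Scope ring_scope.
Local Open Scope classical_set_scope.

(** [u n + C] is subadditive, so the limit is the infimum of [(u n + C) / n] over positive [n],
    finite by the linear lower bound. The inequality for the infimum is kept for later use. *)
Lemma fekete (R : realType) (u : nat -> R) (C B : R) :
  (forall m n, u (m + n)%N <= u m + u n + C) ->
  (forall n, - (B * n%:R) <= u n) ->
  exists l : R, (n%:R^-1 * u n @[n --> \oo] --> l) /\
    forall n, l * n%:R <= u n + C.
Proof.
move=> u_sub u_low.
pose E := [set (u n.+1 + C) / n.+1%:R | n in [set: nat]].
have E_low : lbound E (- (B + `|C|)).
  move=> _ [n _ <-]; rewrite ler_pdivlMr ?ltr0n //.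
  have := u_low n.+1; have := ler_norm (- C); rewrite normrN => C_ge.
  have : `|C| <= `|C| * n.+1%:R by rewrite ler_peMr // ler1n.
  lra.
have E_inf : has_inf E.
  by split; [exists ((u 1%N + C) / 1%:R); exists 0%N | exists (- (B + `|C|))].
have inf_le n : inf E * n%:R <= u n + C.
  case: n => [|n]; first by have := u_sub 0%N 0%N; rewrite addn0 mulr0; lra.
  rewrite -ler_pdivlMr ?ltr0n //.
  by apply: inf_lbound => //; [exact: E_inf.2 | exists n].
exists (inf E); split=> //.
apply/cvgrPdist_lt => e e_gt0.
have e2_gt0 : 0 < e / 2 by rewrite divr_gt0.
have [_ [m0 _ <-] m_lt] := inf_adherent e2_gt0 E_inf.
pose m := m0.+1; set v := _ / _ in m_lt.
have um : u m + C = v * m%:R by rewrite /v mulfVK // pnatr_eq0.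
clearbody v.
(* [W] absorbs the error from the remainder in the Euclidean division of [n] by [m]. *)
pose W := \sum_(r < m) `|u r + C| + `|u m + C| + `|C|.
have W_ge r : (r < m)%N -> `|u r + C| + `|u m + C| + `|C| <= W.
  move=> lt_rm; rewrite /W (bigD1 (Ordinal lt_rm)) //= -!addrA lerD2l.
  by rewrite lerDr sumr_ge0.
have v_le n : u n <= v * n%:R + W.
  have mul_le q r : u (q * m + r)%N + C <= q%:R * (u m + C) + (u r + C).
    elim: q => [|q IH]; first by rewrite mul0n mul0r add0r.
    rewrite mulSn -addnA; apply: le_trans (_ : u m + C + (u (q * m + r)%N + C) <= _).
      by have := u_sub m (q * m + r)%N; lra.
    by rewrite -(natr1 q) mulrDl mul1r; lra.
  have := mul_le (n %/ m)%N (n %% m)%N; rewrite -divn_eq => un.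
  have rm : (n %% m < m)%N by rewrite ltn_mod.
  have := W_ge _ rm; have := ler_norm (u (n %% m)%N + C).
  have := ler_norm (- C); rewrite normrN.
  have : (n %/ m)%:R * (u m + C) <= v * n%:R + `|u m + C|.
    rewrite {2}(divn_eq n m) natrD natrM um mulrDr [v * (_ * _)]mulrCA -addrA lerDl.
    have : - (`|v| * m%:R) <= v * (n %% m)%:R.
      have r_le : (n %% m)%:R <= m%:R :> R by rewrite ler_nat ltnW.
      have := ler_wpM2l (normr_ge0 v) r_le.
      have := ler_norm (- (v * (n %% m)%:R)).
      by rewrite normrN normrM (ger0_norm (ler0n R (n %% m))); lra.
    by rewrite normrM (ger0_norm (ler0n _ m)); lra.
  lra.
near=> n.
have n_gt : (W + `|C|) / (e / 2) < n%:R by near: n; apply: nbhs_infty_gtr.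
have W_ge0 : 0 <= W by rewrite /W !addr_ge0 ?sumr_ge0.
have n_gt0 : 0 < n%:R :> R.
  by apply: le_lt_trans n_gt; apply: divr_ge0; [exact: addr_ge0|exact: ltW].
rewrite ltr_pdivrMr // in n_gt.
rewrite ltr_norml; have := inf_le n; have := v_le n.
have := ler_norm C; have := normr_ge0 C.
set q := n%:R in n_gt0 n_gt *.
have -> : inf E - q^-1 * u n = (inf E * q - u n) / q.
  by rewrite mulrBl mulfK ?gt_eqF // [u n * _]mulrC.
rewrite ltr_pdivlMr // ltr_pdivrMr // => C0 C1 h1 h2.
have := ltr_pM2r n_gt0 v (inf E + e / 2); rewrite m_lt => h3.
apply/andP; split; lra.
Unshelve. all: by end_near.
Qed.

Lemma cvg_ratio_of_linear_bound (R : realType) (F : set_system R)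
    {FF : ProperFilter F} (h : R -> R) (b K : R) :
  (forall M : R, \forall a \near F, M < `|a|)%R ->
  (\forall a \near F, `|h a - b * a| <= K)%R ->
  (h a / a)%R @[a --> F] --> b.
Proof.
move=> F_infty h_lin; apply/cvgrPdist_lt => e e_gt0.
near=> a.
have a_gt0 : (0 < `|a|)%R by near: a; exact: F_infty.
have a_gt : (K / e < `|a|)%R by near: a; exact: F_infty.
have h_a : (`|h a - b * a| <= K)%R by near: a.
have a_neq0 : (a != 0)%R by rewrite -normr_gt0.
have -> : (b - h a / a = - (h a - b * a) / a)%R by field.
rewrite normrM normrN normfV ltr_pdivrMr //.
by apply: le_lt_trans h_a _; rewrite mulrC -ltr_pdivrMr.
Unshelve. all: by end_near.
Qed.

End Asymptotics.

Lemma natr_gt (R : realType) (x : R) : exists n : nat, (x < n%:R)%R.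
Proof.
exists (Num.bound `|x|%R).
exact: le_lt_trans (ler_norm _) (archi_boundP (normr_ge0 _)).
Qed.

(** There are finitely many [p], and for each the least integer above [b * p] is its floor plus one.
    This makes a strict excess over cycles uniform. *)
Lemma int_gap (R : realType) (b : R) M : exists2 e : R, (0 < e)%R &
  forall p (c : int), p <= M -> (b * p%:R < c%:~R)%R -> (e <= c%:~R - b * p%:R)%R.
Proof.
elim: M => [|M [e e_gt0 eP]].
  exists 1%R => // p c; rewrite leqn0 => /eqP ->; rewrite mulr0 subr0.
  by rewrite ltr0z ler1z; lia.
pose e' := ((Num.floor (b * M.+1%:R))%:~R + 1 - b * M.+1%:R)%R.
have e'_gt0 : (0 < e')%R by rewrite subr_gt0 -intrD1 floorD1_gt.
exists (Num.min e e')%R => [|p c]; first by rewrite lt_min e_gt0.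
rewrite leq_eqVlt ltnS => /orP[/eqP -> c_gt|le_p c_gt]; last first.
  by rewrite ge_min eP.
rewrite ge_min /e'; apply/orP; right; rewrite lerD2r -intrD1 ler_int.
by rewrite lezD1 floor_lt_int.
Qed.

(** * Minimal growth of an integer function that is superadditive along geodesics *)

Section ExtremalGrowth.
Local Open Scope classical_set_scope.
Variables (R : realType) (Gam : groupType) (S : {fset Gam}).
Hypothesis hS : symmetric_generators S.
Variables (f : Gam -> int) (C L : nat).
Hypothesis f_superadditive : forall x u : Gam,
  word_length S (x * u)%g = word_length S x + word_length S u ->
  (f x + f u <= f (x * u)%g + C%:Z)%R.
Hypothesis f_lipschitz : forall x, (`|f x| <= (L * word_length S x)%:Z)%R.
Variables (T : finType) (tau : Gam -> T) (N : nat).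
Hypothesis N_gt0 : 0 < N.
Hypothesis tau_step : forall x y u : Gam, tau x = tau y -> word_length S u = N ->
  word_length S (x * u)%g = word_length S x + N ->
  [/\ word_length S (y * u)%g = word_length S y + N,
      tau (x * u)%g = tau (y * u)%g &
      (f (x * u)%g - f x = f (y * u)%g - f y)%R].
Hypothesis sphere_nonempty : forall n, exists x, word_length S x = n.

Notation len := (word_length S).

(** The splitting of [u] into blocks remains geodesic after [x], so [tau_step] applies block by
    block. *)
Lemma tau_blocks k (x y u : Gam) : tau x = tau y -> len u = k * N ->
  len (x * u)%g = len x + len u ->
  [/\ len (y * u)%g = len y + len u, tau (x * u)%g = tau (y * u)%g &
      (f (x * u)%g - f x = f (y * u)%g - f y)%R].
Proof.
elim: k x y u => [|k IH] x y u xy u_len xu.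
  have -> := word_length_eq0 hS u_len.
  by rewrite !mulg1 word_length1 // addn0 !subrr.
have [|v [w [u_eq v_len w_len]]] := @word_length_split _ _ hS u N.
  by rewrite u_len mulSn leq_addr.
have wk : len w = k * N by rewrite w_len u_len mulSn addKn.
have uvw : len u = N + len w by rewrite u_len wk mulSn.
rewrite uvw u_eq !mulgA in xu *.
have := word_lengthM hS (x * v)%g w; have := word_lengthM hS x v => le_xv le_xvw.
have xv : len (x * v)%g = len x + N by length_lia.
have [yv xyv fxy] := tau_step xy v_len xv.
have [|yw xyw fw] := IH _ _ w xyv wk; first by length_lia.
split=> //; first by rewrite yw yv addnA.
by rewrite -(subrKA (f (x * v)%g)) fw fxy subrKA.
Qed.

Lemma minimizer n : exists2 x, len x = n & forall y, len y = n -> (f x <= f y)%R.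
Proof.
have [x0 x0_len] := sphere_nonempty n.
have shift x : len x = n -> (0 <= f x + (L * n)%:Z)%R.
  by move=> x_len; have := f_lipschitz x; rewrite x_len; lia.
have exP : exists k : nat, `[< exists2 x, len x = n & (f x + (L * n)%:Z)%R = k >].
  exists (absz (f x0 + (L * n)%:Z)%R); apply/asboolP; exists x0 => //.
  by rewrite gez0_abs // shift.
case: (ex_minnP exP) => k /asboolP[x x_len xk] k_min.
exists x => // y y_len.
have : k <= absz (f y + (L * n)%:Z)%R.
  apply: k_min; apply/asboolP; exists y => //.
  by rewrite gez0_abs // shift.
by have := shift y y_len; lia.
Qed.

(** Splitting a minimizer at length [a] makes the minima superadditive up to [C]; [fekete] is
    applied to their opposites. *)
Lemma minimum_growth : exists (m : nat -> int) (alpha : R),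
  [/\ forall n, exists2 x, len x = n & f x = m n,
      forall x, (m (len x) <= f x)%R,
      (n%:R^-1 * (m n)%:~R : R)%R @[n --> \oo] --> alpha &
      forall n, ((m n)%:~R <= alpha * n%:R + C%:R)%R].
Proof.
have /choice [z zP] : forall n, exists x, len x = n /\
    forall y, len y = n -> (f x <= f y)%R.
  by move=> n; have [x] := minimizer n; exists x.
pose m n := f (z n).
have m_le x : (m (len x) <= f x)%R by case: (zP (len x)) => _; apply.
have m_super a b : (m a + m b <= m (a + b)%N + C%:Z)%R.
  have [z_len _] := zP (a + b).
  have [|x [u [z_eq x_len u_len]]] := @word_length_split _ _ hS (z (a + b)) a.
    by rewrite z_len leq_addr.
  rewrite /m z_eq; apply: le_trans (f_superadditive _); last first.
    by rewrite -z_eq z_len x_len u_len z_len; lia.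
  by apply: lerD; [have := m_le x; rewrite x_len | have := m_le u;
     rewrite u_len z_len addKn].
have [||l [l_lim l_le]] := @fekete R (fun n => - (m n)%:~R)%R C%:R L%:R.
- move=> a b; have := m_super a b.
  by rewrite -(ler_int R) !intrD -!pmulrn; lra.
- move=> n; rewrite lerN2 -natrM pmulrn ler_int.
  by have := f_lipschitz (z n); rewrite /m (zP n).1; lia.
exists m, (- l)%R; split=> //.
- by move=> n; exists (z n) => //; case: (zP n).
- under eq_fun => n do rewrite -[((m n)%:~R)%R]opprK mulrN.
  exact: cvgN l_lim.
- by move=> n; have := l_le n; lra.
Qed.

(** * Cycles of states and rationality of the minimal growth *)

Section Cycles.
Variables (m : nat -> int) (alpha : R).
Hypothesis m_attained : forall n, exists2 x, len x = n & f x = m n.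
Hypothesis m_min : forall x, (m (len x) <= f x)%R.
Hypothesis m_cvg : (n%:R^-1 * (m n)%:~R : R)%R @[n --> \oo] --> alpha.
Hypothesis m_le : forall n, ((m n)%:~R <= alpha * n%:R + C%:R)%R.

(** The cycle can be repeated: [x] followed by [j] copies of [u] is still geodesic and adds the same
    weight each time, so a lighter cycle would beat the minimal growth [alpha]. *)
Lemma cycle_growth_ge p (x u : Gam) : tau x = tau (x * u)%g -> 0 < p ->
  len u = p * N -> len (x * u)%g = len x + len u ->
  (alpha * N%:R * p%:R <= (f (x * u)%g - f x)%:~R)%R.
Proof.
move=> x_cycle p_gt0 u_len xu.
have pump j : exists y, [/\ tau y = tau x, len y = len x + j * len u &
    (f y = f x + (f (x * u)%g - f x) *+ j)%R].
  elim: j => [|j [y [y_tau y_len fy]]].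
    by exists x; rewrite mulr0n addr0 mul0n addn0.
  have [yu tau_yu fyu] := tau_blocks (esym y_tau) u_len xu.
  exists (y * u)%g; split; first by rewrite -tau_yu.
    by rewrite yu y_len mulSn -addnA [j * _ + _]addnC.
  by rewrite mulrSr addrA -fy fyu addrC subrK.
rewrite leNgt; apply/negP => c_lt.
set c := (f (x * u)%g - f x)%R in pump c_lt.
pose g := (alpha * N%:R * p%:R - c%:~R)%R.
have g_gt0 : (0 < g)%R by rewrite subr_gt0.
have pN_gt0 : (0 < N%:R * p%:R :> R)%R by rewrite mulr_gt0 ?ltr0n.
(* Losing [e] per unit of length costs [g / 2] per turn, as a turn has length [p * N]; half of the
   deficit [g] survives. *)
pose e := (g / 2 / (N%:R * p%:R))%R.
have e_gt0 : (0 < e)%R by rewrite divr_gt0 // divr_gt0.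
have [n0 _ n0P] : \forall n \near \oo, ((alpha - e) * n%:R <= (m n)%:~R)%R.
  have /cvgrPdist_lt /(_ e e_gt0) near_alpha := m_cvg.
  near=> n.
  have n_gt0 : (0 < n%:R :> R)%R by near: n; apply: nbhs_infty_gtr.
  have : (`|alpha - n%:R^-1 * (m n)%:~R| < e)%R by near: n.
  rewrite ltr_norml => /andP[_].
  rewrite ltrBlDr -ltrBlDl mulrC => /ltW; by rewrite ler_pdivlMr.
pose D := ((f x)%:~R - (alpha - e) * (len x)%:R)%R.
have [K K_gt] := natr_gt (D / (g / 2))%R.
pose j := n0 + K.
have [y [_ y_len fy]] := pump j.
have y_large : n0 <= len y.
  have : j <= j * len u by rewrite leq_pmulr // u_len muln_gt0 p_gt0.
  by rewrite y_len /j; lia.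
have := n0P _ y_large; rewrite /= => alpha_le.
have := m_min y; rewrite -(ler_int R) fy intrD => /(le_trans alpha_le).
rewrite y_len natrD natrM u_len natrM mulrDr.
have -> : ((c *+ j)%:~R = j%:R * c%:~R :> R)%R by rewrite rmorphMn /= mulr_natl.
have -> : ((alpha - e) * (j%:R * (p%:R * N%:R)) =
    j%:R * (c%:~R + g / 2))%R.
  transitivity (j%:R * (alpha * N%:R * p%:R - e * (N%:R * p%:R)))%R; first by ring.
  have -> : (alpha * N%:R * p%:R = g + c%:~R)%R by rewrite /g subrK.
  have -> : (e * (N%:R * p%:R) = g / 2)%R by rewrite /e mulfVK ?gt_eqF.
  by congr (_ * _)%R; lra.
have : (D / (g / 2) < j%:R)%R.
  by apply: lt_le_trans K_gt _; rewrite ler_nat leq_addl.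
rewrite ltr_pdivrMr ?divr_gt0 // /D; lra.
Unshelve. all: by end_near.
Qed.

(* If every cycle had growth larger than [alpha], removing cycles from a long
   geodesic would show that [f] exceeds its minimal growth linearly. *)
Lemma minimum_growth_cycle : exists p (c : int),
  0 < p /\ (alpha * N%:R * p%:R = c%:~R)%R.
Proof.
apply: contrapT => no_cycle.
pose M := #|T|.
have [e e_gt0 eP] := int_gap (alpha * N%:R)%R M.
have cycle_gap p x u : tau x = tau (x * u)%g -> 0 < p <= M ->
    len u = p * N -> len (x * u)%g = len x + len u ->
    (e <= (f (x * u)%g - f x)%:~R - alpha * N%:R * p%:R)%R.
  move=> x_cycle /andP[p_gt0 p_le] u_len xu; apply: eP => //.
  rewrite lt_neqAle cycle_growth_ge // andbT.
  by apply/eqP => growth; apply: no_cycle; exists p, (f (x * u)%g - f x)%R.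
have M_gt0 : 0 < M by rewrite /M; apply/card_gt0P; exists (tau 1%g).
have MR_gt0 : (0 < M%:R :> R)%R by rewrite ltr0n.
pose D := (L%:R * N%:R * M%:R + `|alpha * N%:R| * M%:R + e)%R.
(* A cycle of [p <= M] blocks exceeds [alpha] by at least [e], that is, by at least [e / M] per
   block; [D] covers the elements with at most [M] blocks. *)
have slope k x : len x = k * N ->
    (alpha * N%:R * k%:R + e / M%:R * k%:R - D <= (f x)%:~R)%R.
  elim/ltn_ind: k x => k IH x x_len.
  have [k_le|k_gt] := leqP k M.
    have kR : (k%:R <= M%:R :> R)%R by rewrite ler_nat.
    have : (- (L%:R * N%:R * k%:R) <= (f x)%:~R :> R)%R.
      rewrite -!natrM -[((L * N * k)%:R)%R]/(((L * N * k)%:Z)%:~R)%R -mulrNz ler_int.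
      by have := f_lipschitz x; rewrite x_len; lia.
    have : (L%:R * N%:R * k%:R <= L%:R * N%:R * M%:R :> R)%R.
      by rewrite ler_wpM2l // -natrM ler0n.
    have : (alpha * N%:R * k%:R <= `|alpha * N%:R| * M%:R)%R.
      apply: le_trans (ler_norm _) _; rewrite normrM (ger0_norm (ler0n R k)).
      by rewrite ler_wpM2l.
    have : (e / M%:R * k%:R <= e)%R.
      by rewrite -[leRHS](divfK (lt0r_neq0 MR_gt0)) ler_wpM2l // divr_ge0 // ltW.
    by rewrite /D; lra.
  have [w xw w_size] := shortest_word hS x.
  have := is_word_geodesic_path hS xw w_size.
  set q := fun i : nat => (\prod_(s <- take i w) s)%g => q_geo.
  have q0 : q 0 = 1%g by rewrite /q take0 big_nil.
  have qx : q (k * N)%N = x by rewrite /q -x_len -w_size take_size; case: xw.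
  have qij i j : i <= j -> j <= k ->
      len ((q (i * N)%N)^-1 * q (j * N)%N)%g = (j - i) * N.
    move=> le_ij le_jk; rewrite -/(word_dist S _ _) q_geo ?mulnBl //.
      by rewrite leq_mul2r le_ij orbT.
    by rewrite x_len leq_mul2r le_jk orbT.
  have q_len i : i <= k -> len (q (i * N)%N) = i * N.
    by move=> le_ik; have := qij 0 i isT le_ik; rewrite mul0n q0 invg1 mul1g subn0.
  (* Pigeonhole: [M.+1] block ends and [M] states. Removing the cycle between two equal states
     leaves a shorter geodesic for the induction. *)
  have /injectivePn [i0 [j0 ne_ij tau_ij]] :
      ~~ injectiveb (fun i : 'I_M.+1 => tau (q (i * N)%N)).
    apply/negP => /injectiveP /leq_card; by rewrite card_ord ltnn.
  wlog lt_ij : i0 j0 ne_ij tau_ij / i0 < j0.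
    move=> hwlog; have [|lt_ji|/val_inj eq_ij] := ltngtP i0 j0.
    - exact: hwlog.
    - by apply: (hwlog j0 i0); rewrite // eq_sym.
    - by rewrite eq_ij eqxx in ne_ij.
  have le_jM : j0 <= M by rewrite -ltnS.
  have le_jk : j0 <= k by lia.
  have le_ik : i0 <= k by lia.
  pose u := ((q (i0 * N)%N)^-1 * q (j0 * N)%N)%g.
  pose v := ((q (j0 * N)%N)^-1 * x)%g.
  have u_len : len u = (j0 - i0) * N by rewrite qij // ltnW.
  have v_len : len v = (k - j0) * N by rewrite /v -qx qij.
  have iu : (q (i0 * N)%N * u)%g = q (j0 * N)%N by rewrite /u mulVKg.
  have jv : (q (j0 * N)%N * v)%g = x by rewrite /v mulVKg.
  have gap : (e <= (f (q (j0 * N)%N) - f (q (i0 * N)%N))%:~R -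
      alpha * N%:R * (j0 - i0)%:R)%R.
    rewrite -iu; apply: cycle_gap => //; rewrite ?iu //; first by lia.
    by rewrite q_len // u_len q_len // -mulnDl subnKC // ltnW.
  have [|iv _ fv] := tau_blocks (esym tau_ij) v_len.
    by rewrite jv x_len q_len // v_len -mulnDl subnKC.
  have iv_len : len (q (i0 * N)%N * v)%g = (k - (j0 - i0)) * N.
    by rewrite iv q_len // v_len -mulnDl; congr (_ * _); lia.
  have := IH (k - (j0 - i0)) ltac:(lia) _ iv_len.
  have -> : f (q (i0 * N)%N * v)%g = (f x - (f (q (j0 * N)%N) - f (q (i0 * N)%N)))%R.
    by rewrite -jv opprB addrCA fv addrC subrK.
  have p_le : ((j0 - i0)%:R <= M%:R :> R)%R by rewrite ler_nat; lia.
  rewrite natrB; last by lia.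
  have : (e / M%:R * (j0 - i0)%:R <= e)%R.
    by rewrite -[leRHS](divfK (lt0r_neq0 MR_gt0)) ler_wpM2l // divr_ge0 // ltW.
  move: gap; rewrite [((f x - _)%:~R)%R]intrB.
  set c := ((f (q (j0 * N)%N) - f (q (i0 * N)%N))%:~R)%R; set pR := ((j0 - i0)%:R)%R.
  by lra.
(* For large [k] the slope bound at a minimizer contradicts [m_le]. *)
have [k k_gt] := natr_gt ((D + C%:R) / (e / M%:R))%R.
have [x x_len fx] := m_attained (k * N).
have := slope k x x_len; have := m_le (k * N); rewrite fx natrM.
rewrite ltr_pdivrMr in k_gt; last by rewrite divr_gt0.
by lra.
Qed.

Lemma minimum_growth_rational : is_rational alpha.
Proof.
have [p [c [p_gt0 pc]]] := minimum_growth_cycle.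
exists (c%:~R / (N * p)%:R)%R.
rewrite fmorph_div /= ratr_int ratr_nat -pc natrM.
by rewrite -mulrA mulfK // mulf_neq0 // pnatr_eq0 -lt0n.
Qed.

End Cycles.

Lemma rational_minimum_growth : exists (m : nat -> int) (alpha : R),
  [/\ forall n, exists2 x, len x = n & f x = m n,
      forall x, (m (len x) <= f x)%R,
      (n%:R^-1 * (m n)%:~R : R)%R @[n --> \oo] --> alpha &
      is_rational alpha].
Proof.
have [m [alpha [m_attained m_min m_cvg m_le]]] := minimum_growth.
by exists m, alpha; split=> //; exact: (@minimum_growth_rational m).
Qed.

End ExtremalGrowth.

(** * The Manhattan curve *)

(** An empty sphere leaves no longer elements, since prefixes of a shortest word have every smaller
    length. The group is then finite, and normalized counting is an invariant mean. *)
Lemma nonamenable_sphere_nonempty (R : realType) (Gam : groupType)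
    (S : {fset Gam}) : symmetric_generators S -> ~ amenable R Gam ->
  forall n, exists x, word_length S x = n.
Proof.
move=> hS not_amenable n; apply: contrapT => no_x; apply: not_amenable.
have [ball ballP] := word_ball_finite hS n.
pose F := undup ball.
have memF x : x \in F.
  rewrite mem_undup; apply: ballP; rewrite leqNgt; apply/negP => x_gt.
  have [y [z [_ y_len _]]] := word_length_split hS (ltnW x_gt).
  by apply: no_x; exists y.
have F_size : ((size F)%:R != 0 :> R)%R.
  by rewrite pnatr_eq0; have := memF 1%g; case: (F).
exists (fun A => (count (fun x => x \in A) F)%:R / (size F)%:R)%R; split.
- have -> : count (fun x => x \in [set: Gam]%classic) F = size F.
    by apply/eqP; rewrite -all_count; apply/allP => x _; rewrite in_setT.
  by rewrite divff.
- by move=> A; rewrite divr_ge0.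
- move=> A B AB; rewrite -mulrDl -natrD -count_predUI.
  have -> : count (predI (fun x => x \in A) (fun x => x \in B)) F = 0.
    apply/eqP; rewrite -leqn0 leqNgt -has_count; apply/hasPn => x _ /=.
    apply/negP => /andP[/set_mem xA /set_mem xB].
    by have : (A `&` B)%classic x by []; rewrite AB.
  rewrite addn0; congr (_%:R / _)%R; apply: eq_count => x /=.
  by rewrite in_setU.
- move=> g A; congr (_%:R / _)%R.
  have F_perm : perm_eq (map (fun x => g^-1 * x)%g F) F.
    apply: uniq_perm; rewrite ?map_inj_uniq ?undup_uniq //; first exact: mulgI.
    move=> x; rewrite memF; apply/mapP; exists (g * x)%g; first exact: memF.
    by rewrite mulKg.
  rewrite -[RHS](permP F_perm) count_map; apply: eq_count => x /=.
  apply/idP/idP => [/set_mem [y yA <-]|/set_mem xA].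
    by rewrite mulKg; apply/mem_set.
  by apply/mem_set; exists (g^-1 * x)%g; rewrite // mulVKg.
Qed.

Section ManhattanCurve.
Local Open Scope ring_scope.
Local Open Scope classical_set_scope.
Variables (R : realType) (Gam : groupType) (S : {fset Gam}).
Hypothesis hS : symmetric_generators S.
Hypothesis sphere_nonempty : forall n, exists x, word_length S x = n.
Variables (d : Gam -> Gam -> R) (C L : R).
Hypothesis d_additive : forall x u : Gam,
  word_length S (x * u)%g = (word_length S x + word_length S u)%N ->
  `|d 1%g (x * u)%g - d 1%g x - d 1%g u| <= C.
Hypothesis d_lipschitz : forall x, `|d 1%g x| <= L * (word_length S x)%:R.

Notation theta := (manhattan_curve d S).

Definition partition_sum (a : R) (n : nat) : R :=
  \sum_(x <- fset_set (word_sphere S n)) expR (- a * d 1%g x).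

Lemma word_sphere_finite n : finite_set (word_sphere S n).
Proof.
have [ball ballP] := word_ball_finite hS n.
apply: (@sub_finite_set _ _ [set` ball]) => [y y_n|]; last exact: finite_seq.
by apply: ballP; rewrite y_n.
Qed.

Lemma mem_word_sphere n x :
  (x \in fset_set (word_sphere S n)) = (word_length S x == n).
Proof.
rewrite in_fset_set; last exact: word_sphere_finite.
by apply/idP/eqP => [/set_mem|/mem_set].
Qed.

Lemma manhattan_seqE a n :
  manhattan_seq d S a n = n%:R^-1 * ln (partition_sum a n).
Proof. by rewrite /manhattan_seq fsbig_finite //; exact: word_sphere_finite. Qed.

Lemma partition_sum_ge a x :
  expR (- a * d 1%g x) <= partition_sum a (word_length S x).
Proof.
rewrite /partition_sum (big_fsetD1 x) ?mem_word_sphere //= lerDl.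
by apply: sumr_ge0 => y _; rewrite expR_ge0.
Qed.

Lemma partition_sum_gt0 a n : 0 < partition_sum a n.
Proof.
have [x <-] := sphere_nonempty n.
exact: lt_le_trans (expR_gt0 _) (partition_sum_ge a x).
Qed.

Lemma ln_partition_sum_ge a x :
  - a * d 1%g x <= ln (partition_sum a (word_length S x)).
Proof.
by rewrite -[leLHS]expRK ler_ln ?posrE ?expR_gt0 ?partition_sum_gt0
  ?partition_sum_ge.
Qed.

Lemma partition_sum_submul a n m : partition_sum a (n + m) <=
  expR (`|a| * C) * (partition_sum a n * partition_sum a m).
Proof.
rewrite /partition_sum big_distrl /= big_distrr /=.
under [leRHS]eq_bigr do rewrite big_distrr big_distrr /=.
pose G (y z : Gam) : R :=
  expR (`|a| * C) * (expR (- a * d 1%g y) * expR (- a * d 1%g z)).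
pose A k := fset_set (word_sphere S k).
have G_ge0 y z : 0 <= G y z by rewrite !mulr_ge0 ?expR_ge0.
have split_le x : x \in A (n + m)%N -> expR (- a * d 1%g x) <=
    \sum_(y <- A n) \sum_(z <- A m) (if (y * z)%g == x then G y z else 0).
  rewrite mem_word_sphere => /eqP x_len.
  have [|y [z [x_eq y_len z_len]]] := @word_length_split _ _ hS x n.
    by rewrite x_len leq_addr.
  rewrite x_len addKn in z_len.
  rewrite (big_fsetD1 y) ?mem_word_sphere ?y_len //=.
  rewrite (big_fsetD1 z) ?mem_word_sphere ?z_len //= x_eq eqxx.
  rewrite -addrA; apply: (@le_trans _ _ (G y z)); last first.
    rewrite lerDl addr_ge0 ?sumr_ge0 // => [z' _|y' _]; first by case: ifP.
    by apply: sumr_ge0 => z' _; case: ifP.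
  rewrite /G -!expRD ler_expR.
  have : `|a * (d 1%g (y * z)%g - d 1%g y - d 1%g z)| <= `|a| * C.
    rewrite normrM ler_wpM2l // d_additive //.
    by rewrite -x_eq x_len y_len z_len.
  by rewrite ler_norml => /andP[]; lra.
apply: (@le_trans _ _ (\sum_(x <- A (n + m)%N) \sum_(y <- A n) \sum_(z <- A m)
    (if (y * z)%g == x then G y z else 0))).
  by rewrite big_seq [leRHS]big_seq; apply: ler_sum.
(* For fixed [y] and [z], only [x = y * z] can contribute. *)
rewrite exchange_big /=; apply: ler_sum => y _.
rewrite exchange_big /=; apply: ler_sum => z _.
have [yzA|yzA] := boolP ((y * z)%g \in A (n + m)%N).
  rewrite (big_fsetD1 (y * z)%g) //= eqxx big_seq big1 ?addr0 // => x.
  by rewrite !inE eq_sym => /andP[/negbTE ->].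
rewrite big_seq big1 ?G_ge0 // => x xA.
by case: eqP => // yz_x; rewrite yz_x xA in yzA.
Qed.

Lemma manhattan_seq_cvg a : cvgn (manhattan_seq d S a).
Proof.
have [n m||l [l_cvg _]] := @fekete R (fun n => ln (partition_sum a n))
    (`|a| * C) (`|a| * L).
- have Zpos := partition_sum_gt0 a.
  rewrite -[X in _ + X]expRK -!lnM ?posrE ?mulr_gt0 ?expR_gt0 //.
  rewrite ler_ln ?posrE ?mulr_gt0 ?expR_gt0 // mulrC.
  exact: partition_sum_submul.
- move=> n; have [x x_len] := sphere_nonempty n.
  have := ln_partition_sum_ge a x; rewrite x_len; apply: le_trans.
  have := d_lipschitz x; rewrite x_len => /(ler_wpM2l (normr_ge0 a)).
  by rewrite -normrM mulNr lerN2 mulrA; apply: le_trans (ler_norm _).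
apply/cvg_ex; exists l.
by rewrite (funext (manhattan_seqE a)).
Qed.

Lemma manhattan_seq_lim a : manhattan_seq d S a n @[n --> \oo] --> theta a.
Proof. exact: manhattan_seq_cvg. Qed.

Section ExtremalSlope.
Variables (z : nat -> Gam) (beta : R).
Hypothesis z_sphere : forall n, word_length S (z n) = n.
Hypothesis z_cvg : n%:R^-1 * d 1%g (z n) @[n --> \oo] --> beta.

Lemma manhattan_curve_ge a : - a * beta <= theta a.
Proof.
apply: (ler_cvg_to (@cvgMl_tmp _ _ _ _ _ (- a) _ z_cvg) (@manhattan_seq_lim a)).
apply: nearW => n; rewrite manhattan_seqE mulrCA ler_wpM2l ?invr_ge0 //.
by have := ln_partition_sum_ge a (z n); rewrite z_sphere.
Qed.

(** Each term is at most the one at [z n], and the number of terms is [partition_sum 0 n]. The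
    product with [a] in the hypothesis covers minima for [a >= 0] and maxima for [a <= 0]. *)
Lemma manhattan_curve_le a :
  (forall x, a * d 1%g (z (word_length S x)) <= a * d 1%g x) ->
  theta a <= - a * beta + theta 0.
Proof.
move=> z_min.
apply: (ler_cvg_to (@manhattan_seq_lim a)
  (cvgD (@cvgMl_tmp _ _ _ _ _ (- a) _ z_cvg) (@manhattan_seq_lim 0))).
apply: nearW => n; rewrite fctE !manhattan_seqE mulrCA -mulrDr.
rewrite ler_wpM2l ?invr_ge0 //.
rewrite -[X in X + _]expRK -lnM ?posrE ?expR_gt0 ?partition_sum_gt0 //.
rewrite ler_ln ?posrE ?mulr_gt0 ?expR_gt0 ?partition_sum_gt0 //.
rewrite /partition_sum big_distrr /= big_seq [leRHS]big_seq.
apply: ler_sum => x; rewrite mem_word_sphere => /eqP x_len.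
rewrite -expRD ler_expR.
by have := z_min x; rewrite x_len; lra.
Qed.

(** By [manhattan_curve_ge] at [- t], every term of the supremum is nonpositive. *)
Lemma rate_function_finite : (rate_function d S beta < +oo)%E.
Proof.
rewrite /rate_function; apply: (@le_lt_trans _ _ ((theta 0)%:E + 0)%E).
  rewrite leeD2l //; apply: ge_ereal_sup => _ [t _ <-].
  by rewrite lee_fin subr_le0; have := manhattan_curve_ge (- t); rewrite opprK.
by rewrite adde0 ltry.
Qed.

(** The two bounds confine [theta a + a * beta] between [0] and [theta 0]. *)
Lemma manhattan_curve_slope (F : set_system R) {FF : ProperFilter F} :
  (forall M : R, \forall a \near F, M < `|a|) ->
  (\forall a \near F, forall x,
    a * d 1%g (z (word_length S x)) <= a * d 1%g x) ->
  theta a / a @[a --> F] --> - beta.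
Proof.
move=> F_infty F_min.
apply: (@cvg_ratio_of_linear_bound _ _ _ _ _ (theta 0)) => //.
near=> a; have a_min : forall x,
  a * d 1%g (z (word_length S x)) <= a * d 1%g x by near: a.
have := manhattan_curve_ge a; have := manhattan_curve_le a_min.
by move=> le1 le2; rewrite ger0_norm; lra.
Unshelve. all: by end_near.
Qed.

End ExtremalSlope.
End ManhattanCurve.

(** * Extremal sequences for a second word length *)

Lemma rational_opp (R : realType) (x : R) : is_rational x -> is_rational (- x)%R.
Proof. by move=> [q ->]; exists (- q)%R; rewrite rmorphN. Qed.

(** The sign [s] treats minima and maxima together: the growth results apply to [s] times the
    [A]-length, and [s * s = 1] recovers the length itself. *)
Lemma extremal_sequence (R : realType) (Gam : groupType) (S A : {fset Gam})
    (s : int) : non_elementary_hyperbolic R Gam -> symmetric_generators S ->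
  symmetric_generators A -> (`|s| = 1)%R ->
  exists (z : nat -> Gam) (beta : R), [/\ forall n, word_length S (z n) = n,
    (n%:R^-1 * word_metric R A 1%g (z n) @[n --> \oo] --> beta)%R%classic,
    forall x, (s%:~R * word_metric R A 1%g (z (word_length S x)) <=
      s%:~R * word_metric R A 1%g x)%R & is_rational beta].
Proof.
move=> [[S0 hS0 S0_hyp] not_amenable] hS hA s1.
have [Delta four_point] := hyperbolic_word_dist S0_hyp.
have [C super] := word_length_geodesic_superadditive hS0 four_point hS hA.
have [L lip] := word_length_bilipschitz hS hA.
have [T [tau [N [N_gt0 step]]]] := finite_state_structure hS0 four_point hS hA.
have nonempty := nonamenable_sphere_nonempty hS not_amenable.
pose f x := (s * (word_length A x)%:Z)%R.
have s_cases : (s = 1 \/ s = -1)%R by lia.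
have [||x y u xy u_len xu|m [alpha [m_att m_min m_cvg alpha_rat]]] :=
  @rational_minimum_growth R Gam S hS f C L _ _ T tau N N_gt0 _ nonempty.
- move=> x u xu; have := super x u xu; have := word_lengthM hA x u.
  by rewrite /f; case: s_cases => ->; rewrite ?mul1r ?mulN1r; length_lia.
- by move=> x; rewrite /f normrM s1 mul1r; have := lip x; lia.
- have [yu tau_yu fu] := step x y u xy u_len xu; split=> //.
  by rewrite /f -!mulrBr; congr (_ * _)%R; move: fu; length_lia.
have /choice [z zP] : forall n, exists x, word_length S x = n /\ f x = m n.
  by move=> n; have [x] := m_att n; exists x.
have ss : (s%:~R * s%:~R = 1 :> R)%R.
  by rewrite -intrM; case: s_cases => ->; rewrite ?mulrNN mulr1.
have d1 x : word_metric R A 1%g x = ((word_length A x)%:Z)%:~R%R.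
  by rewrite /word_metric invg1 mul1g.
exists z, (s%:~R * alpha)%R; split.
- by move=> n; case: (zP n).
- have -> : (fun n => n%:R^-1 * word_metric R A 1%g (z n))%R =
      (fun n => s%:~R * (n%:R^-1 * (m n)%:~R))%R.
    apply/funext => n; rewrite -(zP n).2 /f d1 intrM mulrCA; congr (_ * _)%R.
    by rewrite mulrA ss mul1r.
  exact: (@cvgMl_tmp _ _ _ _ _ s%:~R%R _ m_cvg).
- move=> x; rewrite !d1 -!intrM ler_int.
  by have := m_min x; rewrite -(zP _).2.
- by case: s_cases alpha_rat => -> => [|/rational_opp]; rewrite ?mul1r ?mulN1r.
Qed.

Theorem corollary4p25 (R : realType) (Gam : groupType)
  (hGam : non_elementary_hyperbolic R Gam)
  (S Sstar : {fset Gam})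
  (hS : symmetric_generators S) (hSstar : symmetric_generators Sstar) :
  let d := word_metric R Sstar in
  [/\ manhattan_limits_exist d S,
      (rate_function d S (alpha_min d S) < +oo)%E
        /\ (rate_function d S (alpha_max d S) < +oo)%E &
      is_rational (alpha_min d S) /\ is_rational (alpha_max d S)].
Proof.
move=> d.
have nonempty := nonamenable_sphere_nonempty hS hGam.2.
have d1 x : d 1%g x = (word_length Sstar x)%:R%R.
  by rewrite /d /word_metric invg1 mul1g.
have [C d_add] : exists C : R, forall x u : Gam,
    word_length S (x * u)%g = (word_length S x + word_length S u)%N ->
    (`|d 1%g (x * u)%g - d 1%g x - d 1%g u| <= C)%R.
  have [[S0 hS0 /hyperbolic_word_dist [Delta four_point]] _] := hGam.
  have [C super] := word_length_geodesic_superadditive hS0 four_point hS hSstar.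
  exists C%:R%R => x u /super; have := word_lengthM hSstar x u.
  rewrite !d1 -!(ler_nat R) !natrD ler_norml; lra.
have [L d_lip] : exists L : R, forall x,
    (`|d 1%g x| <= L * (word_length S x)%:R)%R.
  have [L lip] := word_length_bilipschitz hS hSstar.
  by exists L%:R%R => x; rewrite d1 ger0_norm // -natrM ler_nat.
(* The signs [1] and [-1] give sequences of minimal and of maximal [Sstar]-length, which govern [a]
   near [+oo] and near [-oo] respectively. *)
have [z [beta [z_len z_cvg z_min beta_rat]]] :=
  extremal_sequence hGam hS hSstar (normr1 int).
have [y [gam [y_len y_cvg y_max gam_rat]]] :=
  extremal_sequence hGam hS hSstar (normrN1 int).
have slope_min : (manhattan_curve d S a / a @[a --> +oo] --> - beta)%R%classic.
  apply: (manhattan_curve_slope hS nonempty d_add d_lip z_len z_cvg) => [M|].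
    near=> a; apply: lt_le_trans (ler_norm a).
    by near: a; exact: nbhs_pinfty_gt (num_real _).
  near=> a => x; apply: ler_wpM2l; last by have := z_min x; rewrite !mul1r.
  by near: a; exact: nbhs_pinfty_ge (num_real _).
have slope_max : (manhattan_curve d S a / a @[a --> -oo] --> - gam)%R%classic.
  apply: (manhattan_curve_slope hS nonempty d_add d_lip y_len y_cvg) => [M|].
    near=> a; rewrite -normrN; apply: lt_le_trans (ler_norm _).
    by rewrite ltrNr; near: a; exact: nbhs_ninfty_lt (num_real _).
  near=> a => x; apply: ler_wnM2l; last first.
    by have := y_max x; rewrite mulrN1z !mulN1r lerN2.
  by near: a; exact: nbhs_ninfty_le (num_real _).
have min_eq : alpha_min d S = beta.
  by rewrite /alpha_min (cvg_lim _ slope_min) ?opprK.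
have max_eq : alpha_max d S = gam.
  by rewrite /alpha_max (cvg_lim _ slope_max) ?opprK.
have finite := rate_function_finite hS nonempty d_add d_lip.
rewrite min_eq max_eq; split; split=> //.
- by move=> a; exact: (manhattan_seq_cvg hS nonempty d_add d_lip).
- by apply/cvg_ex; exists (- beta)%R.
- by apply/cvg_ex; exists (- gam)%R.
- exact: finite z_len z_cvg.
- exact: finite y_len y_cvg.
Unshelve. all: by end_near.
Qed.
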